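(* Let $V$ be a 3-dimensional complex vector space with a Hermitian form $h$ of signature $(2,1)$. Let $z_1,z_2,z_3\in V$ be linearly independent non-null vectors such that $h$ restricted to each of $\langle z_1,z_2\rangle$, $\langle z_2,z_3\rangle$, $\langle z_3,z_1\rangle$ is nondegenerate. Put $a_i=h(z_i,z_i)$, $h_{ij}=h(z_i,z_j)$, $\Delta_{ij}=a_ia_j-|h_{ij}|^2$, $q_{ij}=\Delta_{ij}/(a_ia_j)$, $D_{123}=\det(h_{ij})_{1\le i,j\le3}$, $\Omega_{123}=\dfrac{h_{12}h_{23}h_{31}}{a_1a_2a_3}$, $\Theta_{123}=\Omega_{123}+\overline{\Omega_{123}}$, and $$\Sigma_1=\Delta_{31}\Delta_{12}-|h_{31}h_{12}-a_1h_{32}|^2,\quad \Sigma_2=\Delta_{12}\Delta_{23}-|h_{12}h_{23}-a_2h_{13}|^2,\quad \Sigma_3=\Delta_{23}\Delta_{31}-|h_{23}h_{31}-a_3h_{21}|^2.$$ Then $\Sigma_i=a_iD_{123}$ for $i=1,2,3$. Equivalently, whenever the vertex spreads $s_1,s_2,s_3$ (see context) are defined, $$\Delta_{31}\Delta_{12}s_1=a_1D_{123},\qquad \Delta_{12}\Delta_{23}s_2=a_2D_{123},\qquad \Delta_{23}\Delta_{31}s_3=a_3D_{123},$$ and in normalized form $$q_{31}q_{12}s_1=q_{12}q_{23}s_2=q_{23}q_{31}s_3=\frac{D_{123}}{a_1a_2a_3}=q_{12}+q_{23}+q_{31}-2+\Theta_{123}.$$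
   Context: $h$ is linear in the first argument and conjugate-linear in the second; a vector $z$ is non-null if $h(z,z)\neq0$. For $\{i,j,k\}=\{1,2,3\}$ the side polar $p_i$ is a nonzero vector with $h(p_i,z_j)=h(p_i,z_k)=0$. For non-null $x,y$ put $q_H([x],[y])=1-\dfrac{|h(x,y)|^2}{h(x,x)h(y,y)}$. When the relevant side polars are non-null, the vertex spreads are $s_1=q_H([p_2],[p_3])$, $s_2=q_H([p_3],[p_1])$, $s_3=q_H([p_1],[p_2])$. *)

(* Defs.v *)
From HB Require Import structures.
From mathcomp Require Import all_boot all_order all_algebra sesquilinear.
From mathcomp Require Import complex reals.

Set Implicit Arguments.
Unset Strict Implicit.
Unset Printing Implicit Defensive.

Import Order.TTheory GRing.Theory Num.Theory.
Local Open Scope ring_scope.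

(* Linear in the first argument, conjugate-linear in the second.
   All quantities below live in R[i]; on R[i], 0 < x means that x is real and
   positive, and `|x| is the modulus, viewed in R[i]. *)
Notation hermitian_form V := {hermitian V for false & Num.conj}.

Section HermitianTriangle.
Variables (R : realType) (V : vectType R[i]) (h : hermitian_form V).
Implicit Types (x y z p : V).

(* p positive and q negative squares in an orthogonal basis. *)
Definition has_signature (p q : nat) : Prop :=
  exists e : (p + q).-tuple V,
    [/\ basis_of fullv e,
        forall i j : 'I_(p + q), i != j -> h (tnth e i) (tnth e j) = 0
      & forall i : 'I_(p + q),
          if (i < p)%N then 0 < h (tnth e i) (tnth e i)
          else h (tnth e i) (tnth e i) < 0].

Definition nonnull x : Prop := h x x != 0.

Definition nondegenerate_on (W : {vspace V}) : Prop :=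
  (W :&: orthov h W)%VS = 0%VS.

Definition side_polar x y p : Prop := [/\ p != 0, h p x = 0 & h p y = 0].

(* q_H([x],[y]), invariant under rescaling x and y; used for non-null x, y. *)
Definition qH x y : R[i] := 1 - `|h x y| ^+ 2 / (h x x * h y y).

Definition Delta x y : R[i] := h x x * h y y - `|h x y| ^+ 2.

Definition qside x y : R[i] := Delta x y / (h x x * h y y).

Definition gramD x y z : R[i] :=
  let u := [:: x; y; z] in \det (\matrix_(i < 3, j < 3) h u`_i u`_j).

Definition Omega x y z : R[i] :=
  h x y * h y z * h z x / (h x x * h y y * h z z).

Definition Theta x y z : R[i] := Omega x y z + Num.conj (Omega x y z).

(* Sigma_1, Sigma_2, Sigma_3 are Sigma z1 z2 z3, Sigma z2 z3 z1 and
   Sigma z3 z1 z2. *)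
Definition Sigma x y z : R[i] :=
  Delta z x * Delta x y - `|h z x * h x y - h x x * h z y| ^+ 2.

End HermitianTriangle.

(* Main.v *)
(* A side polar [p_i] pairs with vectors only through its [z_i]-coordinate, so
   the inner products of [p_2] and [p_3] reduce to a ratio of coordinates.
   Eliminating the [z_1]-coordinate from the two orthogonality equations of each
   polar expresses that ratio as [|h_31 h_12 - a_1 h_32|^2 / (D_31 D_12)]; hence
   [D_31 D_12 s_1 = Sigma_1].  The identity [Sigma_1 = a_1 D_123] is the
   Desnanot-Jacobi identity for the Gram matrix, and the remaining cases follow
   by cyclic symmetry. *)
Require Import Defs.
From HB Require Import structures.
From mathcomp Require Import all_boot all_order all_algebra sesquilinear.
From mathcomp Require Import complex reals ring.

Import Order.TTheory GRing.Theory Num.Theory.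
Local Open Scope ring_scope.

Lemma det_mx22 (K : comNzRingType) (A : 'M[K]_2) :
  \det A = A ord0 ord0 * A (lift ord0 ord0) (lift ord0 ord0)
         - A ord0 (lift ord0 ord0) * A (lift ord0 ord0) ord0.
Proof.
rewrite (expand_det_row _ ord0) !big_ord_recl big_ord0 /cofactor !det_mx11.
rewrite !mxE /= /bump /= expr0 expr1 mul1r addr0 mulN1r mulrN.
by congr (_ * A _ _ - _ * A _ _); apply: val_inj.
Qed.

Section HermitianTriangle.
Variables (R : realType) (V : vectType R[i]) (h : hermitian_form V).
Implicit Types (x y z p : V).

Lemma hermitian_sym x y : h x y = Num.conj (h y x).
Proof. by rewrite hermC expr0 mul1r. Qed.

Lemma normsq_hermitian x y : `|h x y| ^+ 2 = h x y * h y x.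
Proof. by rewrite normCK -hermitian_sym. Qed.

Lemma DeltaE x y : Delta h x y = h x x * h y y - h x y * h y x.
Proof. by rewrite /Delta normsq_hermitian. Qed.

Lemma gramDE x y z :
  gramD h x y z = h x x * (h y y * h z z - h y z * h z y)
                - h x y * (h y x * h z z - h y z * h z x)
                + h x z * (h y x * h z y - h y y * h z x).
Proof.
rewrite /gramD (expand_det_row _ ord0) !big_ord_recl big_ord0 /cofactor.
by rewrite !det_mx22 !mxE /= /bump /=; ring.
Qed.

Lemma gramD_rot x y z : gramD h y z x = gramD h x y z.
Proof. by rewrite !gramDE; ring. Qed.

(** Conjugating a value of [h] swaps its arguments, so the squared modulus becomes a product of two
    factors polynomial in Gram entries, within reach of [ring]. *)
Lemma SigmaE x y z :
  Sigma h x y z = Delta h z x * Delta h x y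
    - (h z x * h x y - h x x * h z y) * (h x z * h y x - h x x * h y z).
Proof.
rewrite /Sigma normCK; congr (_ - _ * _).
by rewrite rmorphB !rmorphM /= -!hermitian_sym.
Qed.

Lemma Sigma_gramD x y z : Sigma h x y z = h x x * gramD h x y z.
Proof. by rewrite SigmaE !DeltaE gramDE; ring. Qed.

(** The coefficients are the conjugated coordinates of [p], which keeps later computations free of
    conjugation. *)
Lemma hermitian_span3r {x y z p} : p \in <<[:: x; y; z]>>%VS ->
  exists a b c : R[i], forall u, h u p = a * h u x + b * h u y + c * h u z.
Proof.
rewrite !span_cons span_nil addv0.
case/memv_addP=> px /vlineP[a ->] [pyz].
case/memv_addP=> py /vlineP[b ->] [pz /vlineP[c ->] ->] ->.
exists (Num.conj a), (Num.conj b), (Num.conj c) => u.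
by rewrite !linearDr !linearZr_LR addrA.
Qed.

Lemma Delta_qH_side_polar x y z py pz :
  <<[:: x; y; z]>>%VS = fullv ->
  side_polar h z x py -> side_polar h x y pz ->
  nonnull h py -> nonnull h pz ->
  Delta h z x * Delta h x y * qH h py pz = Sigma h x y z.
Proof.
move=> spanV [_ pyz pyx] [_ pzx pzy]; rewrite /nonnull.
have mem_span p : p \in <<[:: x; y; z]>>%VS by rewrite spanV memvf.
have [a [b [c py_coord]]] := hermitian_span3r (mem_span py).
have [a' [b' [c' pz_coord]]] := hermitian_span3r (mem_span pz).
have flip u v : h u v = 0 -> h v u = 0.
  by move=> uv0; rewrite hermitian_sym uv0 rmorph0.
have pypyE : h py py = b * h py y by rewrite py_coord pyx pyz; ring.
have pzpyE : h pz py = c * h pz z by rewrite py_coord pzx pzy; ring.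
have pypzE : h py pz = b' * h py y by rewrite pz_coord pyx pyz; ring.
have pzpzE : h pz pz = c' * h pz z by rewrite pz_coord pzx pzy; ring.
(* Non-nullness of the polars supplies every nonzero factor to be cancelled below. *)
rewrite pypyE pzpzE !mulf_eq0 !negb_or => /andP[b0 pyy0] /andP[c'0 pzz0].
(* Cramer-type elimination of [a] from [h x py = 0] and [h z py = 0]; the minor multiplying [c] is
   [Delta h z x]. *)
have cE : c * Delta h z x = b * (h z x * h x y - h x x * h z y).
  have xpy := flip _ _ pyx; have zpy := flip _ _ pyz.
  move: xpy zpy; rewrite !py_coord => xpy zpy.
  apply/eqP; rewrite -subr_eq0 DeltaE; apply/eqP.
  transitivity (h x x * (a * h z x + b * h z y + c * h z z)
                - h z x * (a * h x x + b * h x y + c * h x z)); first by ring.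
  by rewrite xpy zpy; ring.
(* The same elimination for [pz], with [h y pz = 0] as the second equation; the right-hand factor is
   the conjugate of the one in [cE]. *)
have b'E : b' * Delta h x y = c' * (h x z * h y x - h x x * h y z).
  have xpz := flip _ _ pzx; have ypz := flip _ _ pzy.
  move: xpz ypz; rewrite !pz_coord => xpz ypz.
  apply/eqP; rewrite -subr_eq0 DeltaE; apply/eqP.
  transitivity (h x x * (a' * h y x + b' * h y y + c' * h y z)
                - h y x * (a' * h x x + b' * h x y + c' * h x z)); first by ring.
  by rewrite xpz ypz; ring.
have qHE : qH h py pz = 1 - (c * b') / (b * c').
  rewrite /qH normsq_hermitian pypyE pzpzE pypzE pzpyE.
  by field; rewrite b0 c'0 pyy0 pzz0.
rewrite qHE SigmaE mulrBr mulr1; congr (_ - _).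
(* Each [Delta] is paired with the coordinate that its elimination equation controls, so no division
   by [Delta] occurs. *)
transitivity (c * Delta h z x * (b' * Delta h x y) / (b * c')); first by ring.
by rewrite cE b'E; field; rewrite b0 c'0.
Qed.

(** In the Leibniz expansion divided by the diagonal product, the identity gives 1, each
    transposition gives [qside] minus 1, and the two 3-cycles give [Omega] and its conjugate. *)
Lemma gramD_normalized x y z : nonnull h x -> nonnull h y -> nonnull h z ->
  gramD h x y z / (h x x * h y y * h z z) =
    qside h x y + qside h y z + qside h z x - 2 + Theta h x y z.
Proof.
rewrite /nonnull /qside /Theta /Omega => nx ny nz.
rewrite fmorph_div !rmorphM /= -!hermitian_sym gramDE !DeltaE.
by field; rewrite nx ny nz.
Qed.

End HermitianTriangle.

Theorem theorem10p8 (R : realType) (V : vectType R[i]) (h : hermitian_form V)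
    (z1 z2 z3 : V)
    (dimV : \dim {:V} = 3%N)
    (sgn_h : has_signature h 2 1)
    (free_z : free [:: z1; z2; z3])
    (nn1 : nonnull h z1) (nn2 : nonnull h z2) (nn3 : nonnull h z3)
    (nd12 : nondegenerate_on h <<[:: z1; z2]>>%VS)
    (nd23 : nondegenerate_on h <<[:: z2; z3]>>%VS)
    (nd31 : nondegenerate_on h <<[:: z3; z1]>>%VS) :
  let a1 := h z1 z1 in
  let a2 := h z2 z2 in
  let a3 := h z3 z3 in
  let D12 := Delta h z1 z2 in
  let D23 := Delta h z2 z3 in
  let D31 := Delta h z3 z1 in
  let q12 := qside h z1 z2 in
  let q23 := qside h z2 z3 in
  let q31 := qside h z3 z1 in
  let D123 := gramD h z1 z2 z3 in
  let Theta123 := Theta h z1 z2 z3 in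
  [/\ [/\ Sigma h z1 z2 z3 = a1 * D123,
          Sigma h z2 z3 z1 = a2 * D123
        & Sigma h z3 z1 z2 = a3 * D123],
      forall p1 p2 p3 : V,
        side_polar h z2 z3 p1 ->
        side_polar h z3 z1 p2 ->
        side_polar h z1 z2 p3 ->
        let s1 := qH h p2 p3 in
        let s2 := qH h p3 p1 in
        let s3 := qH h p1 p2 in
        [/\ nonnull h p2 -> nonnull h p3 -> D31 * D12 * s1 = a1 * D123,
            nonnull h p3 -> nonnull h p1 -> D12 * D23 * s2 = a2 * D123,
            nonnull h p1 -> nonnull h p2 -> D23 * D31 * s3 = a3 * D123
          & nonnull h p1 -> nonnull h p2 -> nonnull h p3 ->
            [/\ q31 * q12 * s1 = q12 * q23 * s2,
                q12 * q23 * s2 = q23 * q31 * s3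
              & q23 * q31 * s3 = D123 / (a1 * a2 * a3)]]
    & D123 / (a1 * a2 * a3) = q12 + q23 + q31 - 2 + Theta123].
Proof.
move=> a1 a2 a3 D12 D23 D31 q12 q23 q31 D123 Theta123.
have span123 : <<[:: z1; z2; z3]>>%VS = fullv.
  by apply: span_basis; rewrite basisEfree free_z subvf dimV.
have span231 : <<[:: z2; z3; z1]>>%VS = fullv.
  by rewrite -span123; apply/eq_span/perm_mem; rewrite -(perm_rot 2).
have span312 : <<[:: z3; z1; z2]>>%VS = fullv.
  by rewrite -span123; apply/eq_span/perm_mem; rewrite -(perm_rot 1).
have S1 : Sigma h z1 z2 z3 = a1 * D123 by exact: Sigma_gramD.
have S2 : Sigma h z2 z3 z1 = a2 * D123 by rewrite Sigma_gramD gramD_rot.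
have S3 : Sigma h z3 z1 z2 = a3 * D123 by rewrite Sigma_gramD -gramD_rot.
split; [by [] | | exact: gramD_normalized].
move=> p1 p2 p3 pol1 pol2 pol3 s1 s2 s3.
have E1 : nonnull h p2 -> nonnull h p3 -> D31 * D12 * s1 = a1 * D123.
  by rewrite -S1; exact: Delta_qH_side_polar.
have E2 : nonnull h p3 -> nonnull h p1 -> D12 * D23 * s2 = a2 * D123.
  by rewrite -S2; exact: Delta_qH_side_polar.
have E3 : nonnull h p1 -> nonnull h p2 -> D23 * D31 * s3 = a3 * D123.
  by rewrite -S3; exact: Delta_qH_side_polar.
split=> // np1 np2 np3.
(* Here [a] belongs to the vertex shared by both sides: it occurs twice in the denominators, and the
   factor [a] of [a * D123] cancels one copy. *)
have normalize (a b c D D' s : R[i]) : a != 0 -> b != 0 -> c != 0 ->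
    D * D' * s = a * D123 ->
    D / (c * a) * (D' / (a * b)) * s = D123 / (a * b * c).
  move=> a0 b0 c0 Ds; transitivity (D * D' * s / (c * a * a * b)).
    by field; rewrite a0 b0 c0.
  by rewrite Ds; field; rewrite a0 b0 c0.
have -> : q31 * q12 * s1 = D123 / (a1 * a2 * a3) by apply: normalize; auto.
have -> : q12 * q23 * s2 = D123 / (a1 * a2 * a3).
  (* Cyclic reordering of the denominator puts the current vertex first, as [normalize] expects. *)
  rewrite -[a1 * a2 * a3]mulrA [a1 * (a2 * a3)]mulrC.
  by apply: normalize; auto.
have -> // : q23 * q31 * s3 = D123 / (a1 * a2 * a3).
by rewrite [a1 * a2 * a3]mulrC [a3 * _]mulrA; apply: normalize; auto.
Qed.
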